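(* Let $A,B$ be real symmetric $n\times n$ matrices, $a,b\in\mathbb{R}^n$, $k_1,k_2\in\mathbb{R}$, and $$f(x)=\tfrac12\langle Ax,x\rangle+\langle a,x\rangle+k_1,\qquad g(x)=\tfrac12\langle Bx,x\rangle+\langle b,x\rangle+k_2,\qquad F(x)=(f(x),g(x)),\qquad x\in\mathbb{R}^n.$$ Suppose $g(x_1)<0<g(x_2)$ for some $x_1,x_2\in\mathbb{R}^n$. Let $$\mu=\inf\{f(x): g(x)=0,\ x\in\mathbb{R}^n\},\qquad \nu=\sup_{\lambda\in\mathbb{R}}\inf_{x\in\mathbb{R}^n}\{f(x)+\lambda g(x)\}.$$ Then: ($\mu\in\mathbb{R}$ and strong duality holds for the problem of minimizing $f$ subject to $g(x)=0$) if and only if ($\nu\in\mathbb{R}$ and $F(\mathbb{R}^n)+\mathbb{R}_+(1,0)$ is convex).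
   Context: Strong duality holds for the problem of minimizing $f$ subject to $g(x)=0$ if $\mu=\nu$ and the supremum over $\lambda\in\mathbb{R}$ defining $\nu$ is attained. $\mathbb{R}_+(1,0)=\{(t,0): t\ge 0\}$. *)

(* Defs.v *)
From mathcomp Require Import all_boot all_order all_algebra.
From mathcomp Require Import classical_sets reals ereal convex.

Set Implicit Arguments.
Unset Strict Implicit.
Unset Printing Implicit Defensive.

Import Order.TTheory GRing.Theory Num.Theory.

Local Open Scope classical_set_scope.
Local Open Scope ring_scope.

Definition inner (R : realType) (n : nat) (u v : 'cV[R]_n) : R :=
  \sum_(i < n) u i 0 * v i 0.

Definition quadfun (R : realType) (n : nat) (A : 'M[R]_n) (a : 'cV[R]_n)
    (k : R) (x : 'cV[R]_n) : R :=
  2^-1 * inner (A *m x) x + inner a x + k.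

Definition primal_value (R : realType) (T : Type) (f g : T -> R) : \bar R :=
  ereal_inf [set (f x)%:E | x in [set x | g x = 0]].

Definition dual_fun (R : realType) (T : Type) (f g : T -> R) (lambda : R) :
    \bar R :=
  ereal_inf [set (f x + lambda * g x)%:E | x in [set: T]].

Definition dual_value (R : realType) (T : Type) (f g : T -> R) : \bar R :=
  ereal_sup [set dual_fun f g lambda | lambda in [set: R]].

Definition strong_duality (R : realType) (T : Type) (f g : T -> R) : Prop :=
  primal_value f g = dual_value f g /\
  exists lambda : R, dual_fun f g lambda = dual_value f g.

(* [R^o] is R viewed as a module over itself, so that the plane [R^o * R^o]
   is an R-module, as [convex_set] requires. *)
Definition joint_map (R : realType) (T : Type) (f g : T -> R) (x : T) :
    (R^o * R^o)%type :=
  (f x, g x).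

Definition horizontal_ray (R : realType) : set (R^o * R^o)%type :=
  [set (t, 0) | t in [set t : R | 0 <= t]].

Definition minkowski_sum (V : zmodType) (C D : set V) : set V :=
  [set u + v | u in C & v in D].

(* Main.v *)
(* If strong duality holds then [f + lambda g] is bounded below for some lambda,
   and boundedness below already forces convexity.  Indeed convexity only has to
   be tested on the line through two given points, where [p = f + lambda g] is
   a one-variable quadratic bounded below, hence constant or strictly convex; by
   the intermediate value theorem the quadratic [g] takes the mean of its two
   values on the sublevel set of [p] at the mean level, and subtracting
   [lambda g] gives the corresponding bound on [f].
   Conversely, convexity and the sign condition on [g] give a supporting line at
   [(mu, 0)] that is not horizontal, and its slope is an optimal multiplier. *)
Require Import Defs.
From mathcomp Require Import all_boot all_order all_algebra.
From mathcomp Require Import classical_sets reals ereal convex.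
From mathcomp Require Import interval_inference ring lra.

Set Implicit Arguments.
Unset Strict Implicit.
Unset Printing Implicit Defensive.

Import Order.TTheory GRing.Theory Num.Theory.

Local Open Scope classical_set_scope.
Local Open Scope ring_scope.

(** * Quadratics in one variable *)

Lemma quadratic_ivt (R : rcfType) (c2 c1 c0 u v : R) :
  (c2 * u ^+ 2 + c1 * u + c0) * (c2 * v ^+ 2 + c1 * v + c0) <= 0 ->
  exists w, (w - u) * (w - v) <= 0 /\ c2 * w ^+ 2 + c1 * w + c0 = 0.
Proof.
(* Both conditions are products, hence invariant under swapping [u] and [v] and under negating the
   quadratic. *)
wlog uv : u v / u <= v => [hw|].
  have [uv|/ltW vu] := leP u v; first exact: hw.
  rewrite mulrC => /(hw _ _ vu)[w [wuv w0]].
  by exists w; rewrite mulrC.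
wlog qu : c2 c1 c0 / c2 * u ^+ 2 + c1 * u + c0 <= 0 => [hw|].
  have [qu|/ltW qu] := leP (c2 * u ^+ 2 + c1 * u + c0) 0; first exact: hw.
  move=> quv; have [||w [wuv w0]] := hw (- c2) (- c1) (- c0).
  - by rewrite !mulNr -!opprD oppr_le0.
  - by rewrite !mulNr -!opprD mulrNN.
  by exists w; split=> //; lra.
move=> quv.
have evalE x : (c2%:P * 'X^2 + c1%:P * 'X + c0%:P).[x]
    = c2 * x ^+ 2 + c1 * x + c0 by rewrite !hornerE.
have [qv|qv] := leP 0 (c2 * v ^+ 2 + c1 * v + c0).
  have [|w /andP[uw wv] /rootP w0] :=
    poly_ivt (p := c2%:P * 'X^2 + c1%:P * 'X + c0%:P) uv.
    by rewrite !evalE qu.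
  exists w; rewrite -evalE; split=> //.
  by rewrite mulr_ge0_le0 ?subr_ge0 ?subr_le0.
exists u; rewrite subrr mul0r; split=> //; apply/eqP.
by rewrite eq_le qu -(ler_nM2r qv) mul0r.
Qed.

Lemma quadratic_lbounded (R : realFieldType) (m p2 p1 p0 : R) :
  (forall t, m <= p2 * t ^+ 2 + p1 * t + p0) ->
  0 < p2 \/ p2 = 0 /\ p1 = 0.
Proof.
move=> pm.
have [p2_lt0|p2_gt0|p2_eq0] := ltgtP p2 0; [|by left|right; split=> //].
(* Averaging the bounds at [t] and [- t] removes the linear term; this [t] is large enough to put
   [p2 * t ^+ 2 + p0] below [m]. *)
- exfalso; pose t := 1 - (`|p0 - m| + 1) / p2.
  have p2t : p2 * t = p2 - (`|p0 - m| + 1).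
    by rewrite /t; field; lra.
  have t_ge1 : 1 <= t.
    by rewrite /t lerBrDl gerDr mulr_ge0_le0 ?invr_le0 ?(ltW p2_lt0)//.
  have p2tt : p2 * t ^+ 2 <= p2 * t.
    by rewrite ler_nM2l// expr2 ler_peMr// (le_trans ler01).
  have := pm t; have := pm (- t); have := ler_norm (p0 - m).
  by rewrite sqrrN; lra.
- apply/eqP; apply: contraT => p1_neq0.
  (* The affine function takes the value [m - 1] here. *)
  have := pm ((m - p0 - 1) / p1).
  by rewrite p2_eq0 mul0r add0r mulrC divfK// => ?; lra.
Qed.

Lemma quadratic_epirange_convex (R : rcfType) (m p2 p1 p0 q2 q1 q0 u v th : R) :
  let p t := p2 * t ^+ 2 + p1 * t + p0 in
  let q t := q2 * t ^+ 2 + q1 * t + q0 in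
  (forall t, m <= p t) -> 0 <= th -> th <= 1 ->
  exists t, p t <= th * p u + (1 - th) * p v /\
            q t = th * q u + (1 - th) * q v.
Proof.
move=> p q /quadratic_lbounded p_coef th_ge0 th_le1; rewrite /p /q.
set lev := th * (q2 * _ + _ + _) + _.
have [p2_gt0|[-> ->]] := p_coef; last first.
  (* With [p] constant only [q] matters. Its deviations from [lev] at [u] and [v] are [1 - th] and
     [- th] times the same difference. *)
  have [|t [_ qt]] := @quadratic_ivt R q2 q1 (q0 - lev) u v.
    have -> : (q2 * u ^+ 2 + q1 * u + (q0 - lev)) *
              (q2 * v ^+ 2 + q1 * v + (q0 - lev)) =
      - (th * (1 - th) * (q2 * (u ^+ 2 - v ^+ 2) + q1 * (u - v)) ^+ 2).
      by rewrite /lev; ring.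
    by rewrite oppr_le0 mulr_ge0 ?sqr_ge0// mulr_ge0 ?subr_ge0.
  by exists t; split; lra.
(* [c] is the vertex of [p] and [s] the mean of the squared distances to it,
   so that the sublevel set of [p] at the mean level is [c - r, c + r].  On its
   boundary [q] exceeds [lev] by [e * (+-r - mid)], where [|mid| <= r]. *)
pose c := - p1 / (2 * p2).
have p1E : p1 = - 2 * p2 * c by rewrite /c; field; lra.
pose s := th * (u - c) ^+ 2 + (1 - th) * (v - c) ^+ 2.
have s_ge0 : 0 <= s.
  by apply: addr_ge0; apply: mulr_ge0; rewrite ?sqr_ge0 ?subr_ge0.
pose r := Num.sqrt s; have r2 : r ^+ 2 = s by rewrite sqr_sqrtr.
pose mid := th * (u - c) + (1 - th) * (v - c).
have mid_le : mid ^+ 2 <= s.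
  rewrite -subr_ge0.
  have -> : s - mid ^+ 2 = th * (1 - th) * (u - v) ^+ 2 by rewrite /s /mid; ring.
  by rewrite mulr_ge0 ?sqr_ge0// mulr_ge0 ?subr_ge0.
pose e := q1 + 2 * q2 * c.
have qE x : q2 * (c + x) ^+ 2 + q1 * (c + x) + (q0 - lev) =
    q2 * (x ^+ 2 - s) + e * (x - mid).
  by rewrite /lev /s /mid /e; ring.
have [|t [tr qt]] := @quadratic_ivt R q2 q1 (q0 - lev) (c + r) (c - r).
  rewrite !qE sqrrN r2 subrr mulr0 !add0r.
  have -> : e * (r - mid) * (e * (- r - mid)) = - (e ^+ 2 * (r ^+ 2 - mid ^+ 2)).
    by ring.
  by rewrite oppr_le0 mulr_ge0 ?sqr_ge0// r2 subr_ge0.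
exists t; split; last lra.
have ts : (t - c) ^+ 2 <= s by rewrite -r2; move: tr; rewrite -subr_ge0; nra.
rewrite p1E -subr_ge0.
have -> : th * (p2 * u ^+ 2 + - 2 * p2 * c * u + p0) +
    (1 - th) * (p2 * v ^+ 2 + - 2 * p2 * c * v + p0) -
    (p2 * t ^+ 2 + - 2 * p2 * c * t + p0) = p2 * (s - (t - c) ^+ 2).
  by rewrite /s; ring.
by rewrite mulr_ge0 ?subr_ge0// ltW.
Qed.

(** * Restriction of quadratic functions to lines *)

Lemma innerDl (R : realType) (n : nat) (u v w : 'cV[R]_n) :
  inner (u + v) w = inner u w + inner v w.
Proof.
by rewrite -big_split; apply: eq_bigr => i _; rewrite mxE mulrDl.
Qed.

Lemma innerC (R : realType) (n : nat) (u v : 'cV[R]_n) : inner u v = inner v u.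
Proof. by apply: eq_bigr => i _; rewrite mulrC. Qed.

Lemma innerZl (R : realType) (n : nat) (t : R) (u v : 'cV[R]_n) :
  inner (t *: u) v = t * inner u v.
Proof. by rewrite mulr_sumr; apply: eq_bigr => i _; rewrite mxE mulrA. Qed.

Lemma quadfun_line (R : realType) (n : nat) (A : 'M[R]_n) (a : 'cV[R]_n) (k : R)
    (y d : 'cV[R]_n) (t : R) :
  quadfun A a k (y + t *: d) =
  2^-1 * inner (A *m d) d * t ^+ 2 +
  (2^-1 * (inner (A *m y) d + inner (A *m d) y) + inner a d) * t +
  quadfun A a k y.
Proof.
rewrite /quadfun mulmxDr -scalemxAr !innerDl innerZl.
by rewrite ![inner _ (y + _)]innerC !innerDl !innerZl ![inner _ (_ *m _)]innerC
   ![inner _ a]innerC; ring.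
Qed.

Lemma quadfun_epirange_convex (R : realType) (n : nat) (A B : 'M[R]_n)
    (a b : 'cV[R]_n) (k1 k2 l m : R) :
  let f := quadfun A a k1 in
  let g := quadfun B b k2 in
  (forall x, m <= f x + l * g x) ->
  forall x y th, 0 <= th -> th <= 1 ->
  exists z, f z <= th * f x + (1 - th) * f y /\
            g z = th * g x + (1 - th) * g y.
Proof.
move=> f g flg x y th th_ge0 th_le1.
pose d := x - y.
pose f2 := 2^-1 * inner (A *m d) d.
pose f1 := 2^-1 * (inner (A *m y) d + inner (A *m d) y) + inner a d.
pose g2 := 2^-1 * inner (B *m d) d.
pose g1 := 2^-1 * (inner (B *m y) d + inner (B *m d) y) + inner b d.
have fE t : f (y + t *: d) = f2 * t ^+ 2 + f1 * t + f y by exact: quadfun_line.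
have gE t : g (y + t *: d) = g2 * t ^+ 2 + g1 * t + g y by exact: quadfun_line.
have [|t] := @quadratic_epirange_convex R m (f2 + l * g2) (f1 + l * g1)
  (f y + l * g y) g2 g1 (g y) 1 0 th _ th_ge0 th_le1.
  by move=> t; have := flg (y + t *: d); rewrite fE gE; lra.
have xE : y + 1 *: d = x by rewrite scale1r addrC subrK.
have := fE 1; have := gE 1; rewrite xE => -> -> [pt qt].
exists (y + t *: d); rewrite fE gE qt; split; last by ring.
(* As [g] meets its mean exactly, [l * g] can be subtracted whatever the sign of [l]. *)
have : l * (g2 * t ^+ 2 + g1 * t + g y) =
  l * (th * (g2 * 1 ^+ 2 + g1 * 1 + g y) + (1 - th) * (g2 * 0 ^+ 2 + g1 * 0 + g y)).
  by rewrite qt.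
lra.
Qed.

(** * Convexity of the extended joint range *)

Lemma epirangeP (R : realType) (T : Type) (f g : T -> R) (p : R^o * R^o) :
  minkowski_sum [set joint_map f g x | x in [set: T]] (@horizontal_ray R) p <->
  exists x, f x <= p.1 /\ g x = p.2.
Proof.
split=> [[_ [x _ <-] [_ [t /= t0 <-] <-]]|[x [fx gx]]] /=.
  by exists x; rewrite lerDl addr0.
exists (joint_map f g x); first by exists x.
exists (p.1 - f x, 0); first by exists (p.1 - f x); rewrite //= subr_ge0.
by rewrite [p]surjective_pairing -gx; congr pair => /=; rewrite ?addr0// addrC subrK.
Qed.

(** Testing image points suffices: moving them along the ray only weakens the bound on the first
    coordinate. *)
Lemma epirange_convexP (R : realType) (T : Type) (f g : T -> R) :
  convex_set (minkowski_sum [set joint_map f g x | x in [set: T]]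
                            (@horizontal_ray R)) <->
  forall x y th, 0 <= th -> th <= 1 ->
  exists z, f z <= th * f x + (1 - th) * f y /\
            g z = th * g x + (1 - th) * g y.
Proof.
split=> [cvx x y th th_ge0 th_le1|cvx p1 p2 th].
  have inS z : joint_map f g z \in
      minkowski_sum [set joint_map f g x | x in [set: T]] (@horizontal_ray R).
    by apply/mem_set/epirangeP; exists z.
  by have /set_mem/epirangeP := cvx _ _ (Itv01 th_ge0 th_le1) (inS x) (inS y).
move=> /set_mem/epirangeP[x [fx gx]] /set_mem/epirangeP[y [fy gy]].
have th_ge0 : 0 <= th%:num by [].
have th_le1 : th%:num <= 1 by [].
have [z [fz gz]] := cvx x y _ th_ge0 th_le1.
apply/mem_set/epirangeP; exists z; split; last by rewrite gz gx gy.
apply: (le_trans fz); rewrite lerD// ler_wpM2l// subr_ge0//.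
Qed.

(** * Lagrangian duality *)

Lemma le_dual_fun (R : realType) (T : Type) (f g : T -> R) (l m : R) :
  (forall x, m <= f x + l * g x) <-> (m%:E <= dual_fun f g l)%E.
Proof.
split=> [flg|/ereal_infP flg x].
  by apply/ereal_infP => _ [x _ <-]; rewrite lee_fin.
by rewrite -lee_fin; apply: flg; exists x.
Qed.

Lemma weak_duality (R : realType) (T : Type) (f g : T -> R) :
  (dual_value f g <= primal_value f g)%E.
Proof.
apply/ereal_supP => _ [l _ <-]; apply/ereal_infP => _ [x /= gx <-].
by apply: ereal_inf_lbound; exists x => //; rewrite gx mulr0 addr0.
Qed.

(* A multiplier must satisfy [(m - f x) / g x <= l] where [g x > 0], and the
   reverse inequality where [g x < 0]; the bounds are compatible because a point
   over [g = 0] can be found below every chord joining the two regions. *)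
Lemma multiplier_exists (R : realType) (T : Type) (f g : T -> R) (m : R)
    (x1 x2 : T) :
  g x1 < 0 -> 0 < g x2 ->
  (forall x y th, 0 <= th -> th <= 1 ->
   exists z, f z <= th * f x + (1 - th) * f y /\
             g z = th * g x + (1 - th) * g y) ->
  (forall x, g x = 0 -> m <= f x) ->
  exists l, forall x, m <= f x + l * g x.
Proof.
move=> gx1 gx2 cvx fm.
have slope x y : 0 < g x -> g y < 0 -> (m - f x) / g x <= (m - f y) / g y.
  move=> gx gy; have gxy : 0 < g x - g y by lra.
  (* This weight makes the combination of [g x] and [g y] vanish. *)
  have [||z [fz gz]] := cvx x y (- g y / (g x - g y)).
  - by rewrite divr_ge0; lra.
  - by rewrite ler_pdivrMr//; lra.
  have {}gz : g z = 0 by rewrite gz; field; lra.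
  have := le_trans (fm z gz) fz.
  have -> : - g y / (g x - g y) * f x + (1 - - g y / (g x - g y)) * f y =
    (g x * f y - g y * f x) / (g x - g y) by field; lra.
  rewrite ler_pdivlMr// => h.
  rewrite ler_pdivrMr// mulrAC ler_ndivlMr//; lra.
pose S := [set (m - f x) / g x | x in [set x | 0 < g x]].
have ubS y : g y < 0 -> ubound S ((m - f y) / g y).
  by move=> gy _ [x gx <-]; exact: slope.
(* [x2] makes [S] nonempty and [x1] bounds it, so [sup S] is a genuine supremum. *)
have S0 : S !=set0 by exists ((m - f x2) / g x2); exists x2.
exists (sup S) => x.
have [gx|gx|gx] := ltgtP (g x) 0.
- have := ge_sup S0 (ubS _ gx).
  by rewrite ler_ndivlMr//; lra.
- have : (m - f x) / g x <= sup S.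
    by apply: ub_le_sup; [exists ((m - f x1) / g x1); exact: ubS|exists x].
  by rewrite ler_pdivrMr//; lra.
- by rewrite gx mulr0 addr0 fm.
Qed.

Lemma strong_duality_of_convex (R : realType) (T : Type) (f g : T -> R)
    (x1 x2 : T) :
  g x1 < 0 -> 0 < g x2 ->
  (forall x y th, 0 <= th -> th <= 1 ->
   exists z, f z <= th * f x + (1 - th) * f y /\
             g z = th * g x + (1 - th) * g y) ->
  dual_value f g \is a fin_num ->
  primal_value f g \is a fin_num /\ strong_duality f g.
Proof.
move=> gx1 gx2 cvx; set nu := dual_value f g; set mu := primal_value f g => nu_fin.
have nu_le_mu : (nu <= mu)%E := weak_duality f g.
have [z gz] : exists z, g z = 0.
  have gxy : 0 < g x2 - g x1 by lra.
  have [||z [_ gz]] := cvx x2 x1 (- g x1 / (g x2 - g x1)).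
  - by rewrite divr_ge0; lra.
  - by rewrite ler_pdivrMr//; lra.
  by exists z; rewrite gz; field; lra.
(* Weak duality bounds [mu] from below, the feasible point [z] from above. *)
have mu_fin : mu \is a fin_num.
  rewrite fin_numElt; apply/andP; split.
    by apply: lt_le_trans nu_le_mu; move: nu_fin; rewrite fin_numElt => /andP[].
  apply: (@le_lt_trans _ _ (f z)%:E); last exact: ltry.
  by apply: ereal_inf_lbound; exists z.
have [x gx|l flg] := @multiplier_exists _ _ f g (fine mu) x1 x2 gx1 gx2 cvx.
  by rewrite -lee_fin fineK//; apply: ereal_inf_lbound; exists x.
(* This leads to the cycle [mu <= dual_fun f g l <= nu <= mu]. *)
have mu_le : (mu <= dual_fun f g l)%E by rewrite -[mu]fineK//; apply/le_dual_fun.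
have dual_le : (dual_fun f g l <= nu)%E by apply: ereal_sup_ubound; exists l.
split=> //; split.
  by apply/eqP; rewrite eq_le nu_le_mu (le_trans mu_le dual_le).
exists l; apply/eqP; rewrite eq_le dual_le; exact: le_trans nu_le_mu mu_le.
Qed.

Theorem corollary5p6 (R : realType) (n : nat) (A B : 'M[R]_n)
    (a b : 'cV[R]_n) (k1 k2 : R)
    (A_sym : A^T = A) (B_sym : B^T = B)
    (g_sign : exists x1 x2 : 'cV[R]_n,
       quadfun B b k2 x1 < 0 /\ 0 < quadfun B b k2 x2) :
  let f := quadfun A a k1 in
  let g := quadfun B b k2 in
  let mu := primal_value f g in
  let nu := dual_value f g in
  (mu \is a fin_num /\ strong_duality f g)
  <->
  (nu \is a fin_num /\
   convex_set (minkowski_sum [set joint_map f g x | x in [set: 'cV[R]_n]]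
                             (@horizontal_ray R))).
Proof.
move=> f g mu nu; split.
  move=> [mu_fin [munu [l dual_l]]]; rewrite /nu -munu; split=> //.
  apply/epirange_convexP.
  (* The optimal multiplier supplies the lower bound [fine mu] on [f + l * g]. *)
  have mu_le : ((fine mu)%:E <= dual_fun f g l)%E by rewrite fineK// dual_l -munu.
  by move/le_dual_fun: mu_le; exact: quadfun_epirange_convex.
move=> [nu_fin /epirange_convexP cvx].
have [x1 [x2 [gx1 gx2]]] := g_sign.
exact: strong_duality_of_convex gx1 gx2 cvx nu_fin.
Qed.
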